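(* Let $n\geq2$. The complement $\mathbb{R}^n\setminus\overline{B}$ of a closed (Euclidean) ball $\overline{B}\subset\mathbb{R}^n$ is not a polynomial image of $\mathbb{R}^n$.
   Context: A set $S\subset\mathbb{R}^n$ is a polynomial image of $\mathbb{R}^n$ if $S=f(\mathbb{R}^n)$ for some map $f:\mathbb{R}^n\to\mathbb{R}^n$ with polynomial components. Balls have positive finite radius. *)

(* Defs.v *)
From mathcomp Require Import all_boot all_order all_algebra.
From mathcomp Require Import mpoly.
From mathcomp Require Import classical_sets reals.

Set Implicit Arguments.
Unset Strict Implicit.
Unset Printing Implicit Defensive.

Import Order.TTheory GRing.Theory Num.Theory.

Local Open Scope classical_set_scope.
Local Open Scope ring_scope.

(* The norm `|x| that mathcomp-analysis puts on 'rV[R]_n is the sup norm,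
   hence this explicit Euclidean norm. *)
Definition enorm (R : realType) (n : nat) (x : 'rV[R]_n) : R :=
  Num.sqrt (\sum_(i < n) x ord0 i ^+ 2).

Definition closed_eball (R : realType) (n : nat) (c : 'rV[R]_n) (r : R) :
    set 'rV[R]_n :=
  [set x | enorm (x - c) <= r].

Definition poly_map (R : realType) (n : nat) (p : 'I_n -> {mpoly R[n]})
    (x : 'rV[R]_n) : 'rV[R]_n :=
  \row_(i < n) (p i).@[fun j : 'I_n => x ord0 j].

Definition polynomial_image (R : realType) (n : nat) (S : set 'rV[R]_n) :
    Prop :=
  exists p : 'I_n -> {mpoly R[n]}, S = range (poly_map p).

(* Main.v *)
Require Import Defs.
From mathcomp Require Import all_boot all_order all_algebra.
From mathcomp Require Import classical_sets reals.
From mathcomp Require Import boolp topology normedtype derive realfun.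
From mathcomp Require mpoly.
From mathcomp Require Import lra ring zify.

(* Let F be a polynomial self-map of R^n whose image is the complement of the
   closed unit ball.  Each coordinate x_i is algebraic over R(F_1, ..., F_n);
   let a(y) be the product over i of the leading coefficients of these
   relations.  If x tends to infinity while F(x) stays bounded, then a(F(x))
   tends to 0; and if a(F(x)) <> 0, then F is nonconstant on every line through
   x parallel to an axis.  Writing a(y) = (|y| - 1)^k c(y) with c nonzero near
   some point u of the sphere, one sees that near u the points F(x) with x far
   away must be close to the sphere.

   Since u is a boundary point of the image, there is x with F(x) close to u,
   and x is far away, say in the coordinate i.  Move along the line x + s e_j
   with j <> i (here n >= 2 is used), at the scale for which F moves by a fixed
   small amount: the coordinate i is unchanged, so this polynomial curve, which
   is nonconstant at a definite scale, stays arbitrarily close to the sphere.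
   That is impossible, as a nonconstant polynomial curve is unbounded. *)

Set Implicit Arguments.
Unset Strict Implicit.
Unset Printing Implicit Defensive.

Import Order.TTheory GRing.Theory Num.Theory numFieldNormedType.Exports.

Local Open Scope classical_set_scope.
Local Open Scope ring_scope.

(** * Univariate polynomials: vanishing and coefficient bounds *)

Lemma poly_eq0_nat (R : numDomainType) (q : {poly R}) (N : nat) :
  (forall k : nat, (N <= k)%N -> q.[k%:R] = 0) -> q = 0.
Proof.
move=> hq; apply/eqP/negPn/negP => q0.
have := @max_poly_roots _ q [seq k%:R | k <- iota N (size q)] q0.
rewrite size_map size_iota ltnn => H; suff: false by []; apply: H.
  apply/allP => _ /mapP[k + ->]; rewrite mem_iota => /andP[Nk _].
  by rewrite /root hq.
by rewrite map_inj_uniq ?iota_uniq //; apply: mulrIn; rewrite oner_eq0.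
Qed.

Lemma poly_eq0_small (R : numDomainType) (q : {poly R}) (d : nat) :
  (size q <= d)%N -> (forall k : nat, (k < d)%N -> q.[k%:R] = 0) -> q = 0.
Proof.
move=> sq hq; apply/eqP/negPn/negP => q0.
have := @max_poly_roots _ q [seq k%:R | k <- iota 0 d] q0.
rewrite size_map size_iota ltnNge sq => H; suff: false by []; apply: H.
  apply/allP => _ /mapP[k + ->]; rewrite mem_iota => /andP[_ kd].
  by rewrite /root hq.
by rewrite map_inj_uniq ?iota_uniq //; apply: mulrIn; rewrite oner_eq0.
Qed.

(* The dilation [q(s) - 2^(d+1) q(s/2)] kills the top coefficient, which makes
   an induction on the degree possible. *)
Lemma coef_le_sup (R : realFieldType) (d : nat) :
  exists2 K : R, 0 < K & forall (q : {poly R}) (B : R), (size q <= d.+1)%N ->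
    (forall s, `|s| <= 1 -> `|q.[s]| <= B) -> forall l, `|q`_l| <= K * B.
Proof.
elim: d => [|d [K K0 IH]].
  exists 1 => // q B /size1_polyC ->  hq l; rewrite mul1r.
  have := hq 0; rewrite normr0 ler01 hornerC => /(_ isT) hB.
  rewrite coefC; case: eqP => // _; rewrite normr0.
  exact: le_trans hB.
pose c : R := 2 ^+ d.+1.
have c0 : 0 < c by rewrite exprn_gt0.
have K'0 : 0 < K * (1 + c) by rewrite mulr_gt0 // addr_gt0.
(* [K * (1 + c)] serves the coefficients of index at most [d]; the top one is [q.[1]] minus those
   [d.+1] coefficients. *)
exists (1 + (d.+1)%:R * (K * (1 + c))) => [|q B sq hq].
  by rewrite ltr_wpDr // mulr_ge0 // ltW.
have B0 : 0 <= B by apply: le_trans (hq 0 _); rewrite ?normr0.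
pose p := \poly_(l < d.+1) (q`_l * (1 - 2 ^+ (d.+1 - l))).
have pE s : p.[s] = q.[s] - c * q.[s / 2].
  rewrite (horner_coef_wide s sq) (horner_coef_wide (s / 2) sq) horner_poly.
  rewrite mulr_sumr -sumrB [RHS]big_ord_recr /= expr_div_n.
  rewrite [X in _ = _ + X](_ : _ = 0) ?addr0; last first.
    by rewrite -/c; field; rewrite lt0r_neq0.
  apply: eq_bigr => i _; rewrite expr_div_n.
  have -> : c = 2 ^+ (d.+1 - i) * 2 ^+ i by rewrite -exprD subnK // ltnW.
  have x0 : (2 : R) ^+ i != 0 by rewrite expf_neq0 ?pnatr_eq0.
  by move: (2 ^+ i) (2 ^+ (d.+1 - i)) (s ^+ i) x0 => x y z x0; field.
have hp l : `|p`_l| <= K * (1 + c) * B.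
  rewrite -mulrA; apply: IH => [|s s1]; first exact: size_poly.
  rewrite pE (le_trans (ler_normB _ _)) // mulrDl mul1r; apply: lerD; first exact: hq.
  rewrite normrM (gtr0_norm c0) ler_wpM2l ?(ltW c0) // hq //.
  by rewrite normrM normfV (gtr0_norm (@ltr0n _ 2)) //; lra.
(* For [l <= d] the factor [1 - 2 ^+ (d.+1 - l)] has absolute value at least 1. *)
have hl l : (l <= d)%N -> `|q`_l| <= K * (1 + c) * B.
  move=> ld; apply: le_trans (hp l); rewrite coef_poly ltnS ld normrM ler_peMr //.
  have : (2 : R) <= 2 ^+ (d.+1 - l)
    by rewrite subSn // exprS ler_peMr // exprn_ege1 // ler1n.
  by move=> h; rewrite ler0_norm; lra.
move=> l; case: (leqP l d) => [/hl h|dl].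
  apply: le_trans h _; rewrite ler_wpM2r // -addn1 natrD mulrDl mul1r.
  by rewrite addrA lerDr addr_ge0 // mulr_ge0 // ltW.
have [->|] := eqVneq l d.+1; last first.
  move=> ld; rewrite nth_default ?normr0; last by apply: leq_trans sq _; lia.
  by rewrite mulr_ge0 // addr_ge0 // mulr_ge0 // ltW.
have -> : q`_d.+1 = q.[1] - \sum_(l < d.+1) q`_l.
  rewrite (horner_coef_wide 1 sq) big_ord_recr /= expr1n mulr1.
  by under eq_bigr do rewrite expr1n mulr1; rewrite addrAC subrr add0r.
rewrite (le_trans (ler_normB _ _)) // mulrDl mul1r; apply: lerD.
  by rewrite hq ?normr1.
rewrite (le_trans (ler_norm_sum _ _ _)) // -mulrA -[d.+1 in leRHS]card_ord -sum1_card.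
rewrite natr_sum mulr_suml ler_sum // => i _; rewrite mul1r hl //.
by rewrite -ltnS.
Qed.

(** * Tools for counting monomials *)

(** A matrix with more rows than columns has dependent rows. Finite index types allow unknowns
    indexed by pairs and equations indexed by grid points. *)
Lemma exists_left_kernel (K : fieldType) (I J : finType) (c : I -> J -> K) :
  (#|J| < #|I|)%N ->
  exists2 u : I -> K, (exists i, u i != 0) & forall j, \sum_i u i * c i j = 0.
Proof.
move=> JI.
pose A := \matrix_(i < #|I|, j < #|J|) c (enum_val i) (enum_val j).
have : kermx A != 0.
  rewrite kermx_eq0 /row_free neq_ltn.
  by rewrite (leq_ltn_trans (rank_leq_col A)).
case/rowV0Pn => v /sub_kermxP vA v0.
exists (fun i => v 0 (enum_rank i)).
  have [i vi] : exists i, v 0 i != 0.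
    apply/existsP; apply: contra_neqT v0 => /existsPn h.
    by apply/rowP => i; rewrite mxE; apply/eqP; rewrite -[_ == _]negbK h.
  by exists (enum_val i); rewrite enum_valK.
move=> j; have := congr1 (fun M : 'rV_ _ => M 0 (enum_rank j)) vA.
rewrite !mxE => vAj; rewrite -[RHS]vAj [RHS](reindex enum_rank) /=; last first.
  by exists enum_val => i _; rewrite ?enum_rankK ?enum_valK.
by apply: eq_bigr => i _; rewrite mxE !enum_rankK.
Qed.

Lemma sum_digits (M n m : nat) : (0 < M)%N ->
  (\sum_(j < n) (m %/ M ^ j %% M) * M ^ j = m %% M ^ n)%N.
Proof.
move=> M0; elim: n => [|n IH]; first by rewrite big_ord0 modn1.
rewrite big_ord_recr /= IH; set P := (M ^ n)%N.
have P0 : (0 < P)%N by rewrite expn_gt0 M0.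
have -> : (M ^ n.+1 = M * P)%N by rewrite expnS.
rewrite [in RHS](divn_eq m P) [in RHS](divn_eq (m %/ P) M).
rewrite mulnDl -mulnA -addnA modnMDl addnC.
have := ltn_pmod m P0; have := ltn_pmod (m %/ P) M0.
set a := (_ %% M)%N; set b := (m %% P)%N => aM bP.
rewrite modn_small //.
apply: (@leq_trans (a.+1 * P)%N); last by rewrite leq_mul2r aM orbT.
by rewrite mulSn addnC ltn_add2r.
Qed.

(** * Polynomial functions and their degree on lines *)

(** This form gives continuity, bounds on boxes and degree bounds by induction, without handling
    multinomials. *)
Inductive polyfun (R : realType) (n : nat) : ('rV[R]_n -> R) -> Prop :=
| polyfun_cst a : polyfun (fun=> a)
| polyfun_coord i : polyfun (fun x => x 0 i)
| polyfunD f g : polyfun f -> polyfun g -> polyfun (fun x => f x + g x)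
| polyfunM f g : polyfun f -> polyfun g -> polyfun (fun x => f x * g x).

Lemma polyfun_sum (R : realType) n I (r : seq I) (f : I -> 'rV[R]_n -> R) :
  (forall i, polyfun (f i)) -> polyfun (fun x => \sum_(i <- r) f i x).
Proof.
move=> hf; elim: r => [|i r IH].
  rewrite (_ : (fun _ => _) = fun=> 0); first exact: polyfun_cst.
  by apply/funext => x; rewrite big_nil.
rewrite (_ : (fun _ => _) = fun x => f i x + \sum_(i <- r) f i x).
  exact: polyfunD.
by apply/funext => x; rewrite big_cons.
Qed.

Lemma polyfun_prod (R : realType) n I (r : seq I) (f : I -> 'rV[R]_n -> R) :
  (forall i, polyfun (f i)) -> polyfun (fun x => \prod_(i <- r) f i x).
Proof.
move=> hf; elim: r => [|i r IH].
  rewrite (_ : (fun _ => _) = fun=> 1); first exact: polyfun_cst.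
  by apply/funext => x; rewrite big_nil.
rewrite (_ : (fun _ => _) = fun x => f i x * \prod_(i <- r) f i x).
  exact: polyfunM.
by apply/funext => x; rewrite big_cons.
Qed.

Lemma polyfunX (R : realType) n (f : 'rV[R]_n -> R) k :
  polyfun f -> polyfun (fun x => f x ^+ k).
Proof.
move=> hf; elim: k => [|k IH]; first exact: polyfun_cst.
rewrite (_ : (fun _ => _) = fun x => f x * f x ^+ k); first exact: polyfunM.
by apply/funext => x; rewrite exprS.
Qed.

Lemma polyfun_meval (R : realType) n (p : mpoly.mpoly n R) :
  polyfun (fun x : 'rV[R]_n => mpoly.meval (fun j => x 0 j) p).
Proof.
rewrite (_ : (fun _ => _) = fun x : 'rV[R]_n => \sum_(m <- mpoly.msupp p)
  mpoly.mcoeff m p * \prod_i x 0 i ^+ mpoly.fun_of_multinom m i); last first.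
  by apply/funext => x; rewrite mpoly.mevalE.
apply: polyfun_sum => m; apply: polyfunM; first exact: polyfun_cst.
by apply: polyfun_prod => i; apply/polyfunX/polyfun_coord.
Qed.

Lemma polyfun_continuous (R : realType) n (f : 'rV[R]_n -> R) :
  polyfun f -> continuous f.
Proof.
elim=> [a|i|{}f g _ hf _ hg|{}f g _ hf _ hg] x.
- exact: cst_continuous.
- exact: coord_continuous.
- exact: (cvgD (hf x) (hg x)).
- exact: (cvgM (hf x) (hg x)).
Qed.

Lemma polyfun_bounded (R : realType) n (f : 'rV[R]_n -> R) (B : R) :
  polyfun f ->
  exists2 C : R, 0 <= C & forall x : 'rV[R]_n, (forall i, `|x 0 i| <= B) -> `|f x| <= C.
Proof.
elim=> [a|i|{}f g _ [C C0 hC] _ [C' C'0 hC']|{}f g _ [C C0 hC] _ [C' C'0 hC']].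
- by exists `|a|.
- exists `|B| => // x /(_ i) h; exact: le_trans h (ler_norm _).
- exists (C + C') => [|x hx]; first exact: addr_ge0.
  by rewrite (le_trans (ler_normD _ _)) // lerD ?hC ?hC'.
- exists (C * C') => [|x hx]; first exact: mulr_ge0.
  by rewrite normrM ler_pM ?hC ?hC'.
Qed.

(** For a polynomial function this bounds the total degree; read on lines parallel to the axes, it
    bounds the degree in each variable. *)
Definition line_degree_le (R : realType) n (d : nat) (f : 'rV[R]_n -> R) :=
  forall x v, exists2 q : {poly R},
    (size q <= d.+1)%N & forall s, f (x + s *: v) = q.[s].

Lemma line_degree_leW (R : realType) n d d' (f : 'rV[R]_n -> R) :
  (d <= d')%N -> line_degree_le d f -> line_degree_le d' f.
Proof.
by move=> dd' hf x v; have [q sq hq] := hf x v; exists q => //; apply: leq_trans sq _.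
Qed.

Lemma line_degree_le_cst (R : realType) n (a : R) :
  line_degree_le 0 (fun _ : 'rV[R]_n => a).
Proof. by move=> x v; exists a%:P => [|s]; rewrite ?size_polyC_leq1 ?hornerC. Qed.

Lemma line_degree_le_coord (R : realType) n (i : 'I_n) :
  line_degree_le 1 (fun x : 'rV[R]_n => x 0 i).
Proof.
move=> x v; exists ((x 0 i)%:P + v 0 i *: 'X) => [|s].
  rewrite (leq_trans (size_polyD _ _)) // geq_max (leq_trans (size_polyC_leq1 _)) //.
  by rewrite (leq_trans (size_scale_leq _ _)) ?size_polyX.
by rewrite !hornerE !mxE mulrC.
Qed.

Lemma line_degree_leD (R : realType) n d (f g : 'rV[R]_n -> R) :
  line_degree_le d f -> line_degree_le d g ->
  line_degree_le d (fun x => f x + g x).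
Proof.
move=> hf hg x v; have [q sq hq] := hf x v; have [p sp hp] := hg x v.
exists (q + p) => [|s]; last by rewrite hornerD hq hp.
by rewrite (leq_trans (size_polyD _ _)) // geq_max sq.
Qed.

Lemma line_degree_leM (R : realType) n d e (f g : 'rV[R]_n -> R) :
  line_degree_le d f -> line_degree_le e g ->
  line_degree_le (d + e) (fun x => f x * g x).
Proof.
move=> hf hg x v; have [q sq hq] := hf x v; have [p sp hp] := hg x v.
exists (q * p) => [|s]; last by rewrite hornerM hq hp.
by rewrite (leq_trans (size_polyMleq _ _)) //; lia.
Qed.

Lemma line_degree_leX (R : realType) n d k (f : 'rV[R]_n -> R) :
  line_degree_le d f -> line_degree_le (k * d) (fun x => f x ^+ k).
Proof.
move=> hf; elim: k => [|k IH]; first exact: line_degree_le_cst.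
rewrite (_ : (fun _ => _) = fun x => f x * f x ^+ k).
  exact: line_degree_leM.
by apply/funext => x; rewrite exprS.
Qed.

Lemma line_degree_le_prod (R : realType) n d I (r : seq I)
    (f : I -> 'rV[R]_n -> R) : (forall i, line_degree_le d (f i)) ->
  line_degree_le (size r * d) (fun x => \prod_(i <- r) f i x).
Proof.
move=> hf; elim: r => [|i r IH].
  rewrite (_ : (fun _ => _) = fun=> 1); first exact: line_degree_le_cst.
  by apply/funext => x; rewrite big_nil.
rewrite (_ : (fun _ => _) = fun x => f i x * \prod_(i <- r) f i x).
  exact: line_degree_leM.
by apply/funext => x; rewrite big_cons.
Qed.

Lemma line_degree_le_sum (R : realType) n d I (r : seq I)
    (f : I -> 'rV[R]_n -> R) : (forall i, line_degree_le d (f i)) ->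
  line_degree_le d (fun x => \sum_(i <- r) f i x).
Proof.
move=> hf; elim: r => [|i r IH].
  rewrite (_ : (fun _ => _) = fun=> 0).
    by apply: line_degree_leW (line_degree_le_cst _).
  by apply/funext => x; rewrite big_nil.
rewrite (_ : (fun _ => _) = fun x => f i x + \sum_(i <- r) f i x).
  exact: line_degree_leD.
by apply/funext => x; rewrite big_cons.
Qed.

Lemma polyfun_line_degree (R : realType) n (f : 'rV[R]_n -> R) :
  polyfun f -> exists d, line_degree_le d f.
Proof.
elim=> [a|i|{}f g _ [d hd] _ [e he]|{}f g _ [d hd] _ [e he]].
- by exists 0; exact: line_degree_le_cst.
- by exists 1; exact: line_degree_le_coord.
- exists (maxn d e); apply: line_degree_leD.
    by apply: line_degree_leW hd; rewrite leq_maxl.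
  by apply: line_degree_leW he; rewrite leq_maxr.
- by exists (d + e)%N; exact: line_degree_leM.
Qed.

Lemma polyfun_family_line_degree (R : realType) n (I : finType)
    (f : I -> 'rV[R]_n -> R) : (forall i, polyfun (f i)) ->
  exists d, forall i, line_degree_le d (f i).
Proof.
move=> hf; have /choice[d hd] i := polyfun_line_degree (hf i).
by exists (\max_i d i) => i; apply: line_degree_leW (hd i); exact: leq_bigmax.
Qed.

(** * Algebraic dependence of each coordinate on the components of [F] *)

(** Coordinates are freed one at a time, the first [k] being free in [H]: along the next axis, [f]
    has degree at most [d] and [d.+1] roots. Thus [d.+1 ^ n] linear conditions force [f] to
    vanish. *)
Lemma line_degree_le_grid_eq0 (R : realType) n d (f : 'rV[R]_n -> R) :
  line_degree_le d f ->
  (forall g : {ffun 'I_n -> 'I_d.+1}, f (\row_i (g i)%:R) = 0) ->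
  forall x, f x = 0.
Proof.
move=> hf hg x.
suff H k : forall (g : {ffun 'I_n -> 'I_d.+1}) (x : 'rV[R]_n),
    (forall i : 'I_n, (k <= i)%N -> x 0 i = (g i)%:R) -> f x = 0.
  by apply: (H n [ffun=> ord0]) => i; rewrite leqNgt ltn_ord.
elim: k => [|k IH] {x} g x hx.
  rewrite (_ : x = \row_i (g i)%:R) ?hg //.
  by apply/rowP => i; rewrite mxE hx.
have [kn|nk] := ltnP k n; last first.
  by apply: (IH g) => i; rewrite leqNgt (leq_trans (ltn_ord i) nk).
pose i0 := Ordinal kn.
pose e := \row_i (i == i0)%:R : 'rV[R]_n.
have [q sq hq] := hf (x - x 0 i0 *: e) e.
have q0 : q = 0.
  apply: (poly_eq0_small sq) => m md; rewrite -hq.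
  apply: (IH [ffun i => if i == i0 then inord m else g i]) => i ki.
  rewrite ffunE !mxE; have [->|ii0] := eqVneq i i0.
    by rewrite inordK // !mulr1 subrr add0r.
  rewrite !mulr0 subr0 addr0 hx // ltn_neqAle ki andbT.
  by apply: contraNneq ii0 => k_i; apply/eqP/val_inj.
by rewrite -[x](subrK (x 0 i0 *: e)) hq q0 horner0.
Qed.

(* Count: the products [F^m x_i0^l] with all exponents at most [M'] are
   [M'.+1 ^ n.+1] functions in a space of dimension [E.+1 ^ n].  The base
   [M'.+1] digits [dig m] index the exponents, so that at the Kronecker point
   [y_j = z ^ (M'.+1 ^ j)] the monomial of index [m] takes the value [z ^ m]. *)
Lemma algebraic_relation (R : realType) n (F : 'rV[R]_n -> 'rV[R]_n) (D : nat) :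
  (forall i, line_degree_le D (fun x => F x 0 i)) ->
  exists M : nat, forall i0 : 'I_n,
  exists (d : nat) (a : nat -> 'rV[R]_n -> R) (q : {poly R}),
    [/\ forall l, polyfun (a l),
        forall x, \sum_(l < d.+1) a l (F x) * x 0 i0 ^+ l = 0,
        q != 0 &
        forall z, a d (\row_j z ^+ (M.+1 ^ j)) = q.[z]].
Proof.
(* With [M = M'.+1] there are [M ^ n.+1] unknowns, and at most [((n * D).+1 * M) ^ n = M' * M ^ n]
   equations by this choice of [M']. *)
move=> hF; pose M' := ((n * D).+1 ^ n)%N; exists M' => i0.
set M := M'.+1.
pose dig m j := ((m %/ M ^ j) %% M)%N.
pose G (m l : nat) (y : 'rV[R]_n) := \prod_(j < n) y 0 j ^+ dig m j.
pose E := (n * (M' * D) + M')%N.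
have hG m (l : 'I_M) :
    line_degree_le E (fun x => G m l (F x) * x 0 i0 ^+ l).
  apply: line_degree_leM.
    apply: (@line_degree_leW _ _ (size (index_enum 'I_n) * (M' * D))).
      by rewrite -sum1_size sum1_card card_ord.
    apply: line_degree_le_prod => j.
    apply: line_degree_leW (line_degree_leX _ (hF j)).
    by rewrite leq_mul2r -ltnS ltn_mod orbT.
  apply: line_degree_leW (line_degree_leX _ (@line_degree_le_coord R n i0)).
  by rewrite muln1 -ltnS.
pose grid (g : {ffun 'I_n -> 'I_E.+1}) : 'rV[R]_n := \row_i (g i)%:R.
have [|u [[m0 l0] u0] hu] := @exists_left_kernel R ('I_(M ^ n) * 'I_M)%type
  {ffun 'I_n -> 'I_E.+1} (fun ml g => G ml.1 ml.2 (F (grid g)) * grid g 0 i0 ^+ ml.2).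
  rewrite card_ffun card_prod !card_ord.
  have hE : (E.+1 <= (n * D).+1 * M)%N by rewrite /E /M; nia.
  apply: (@leq_ltn_trans (((n * D).+1 * M) ^ n)).
    have leX a b k : (a <= b)%N -> (a ^ k <= b ^ k)%N.
      by case: k => // k; rewrite leq_exp2r.
    exact: leX.
  by rewrite expnMn mulnC ltn_pmul2l ?expn_gt0 // /M ltnS.
pose P (l : nat) := (l < M)%N && [exists m, u (m, inord l) != 0].
have exP : exists l, P l.
  by exists l0; rewrite /P ltn_ord; apply/existsP; exists m0; rewrite inord_val.
have ubP l : P l -> (l <= M')%N by case/andP.
(* Stopping at the largest exponent [d] that occurs loses no term and makes the leading coefficient
   a nonzero polynomial. *)
case: (ex_maxnP exP ubP) => d /andP[dM /existsP[m1 um1]] dmax.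
exists d, (fun l y => \sum_(m < M ^ n) u (m, inord l) * G m l y).
exists (\poly_(m < M ^ n) (if insub m is Some m' then u (m', inord d) else 0)).
split.
- move=> l; apply: polyfun_sum => m; apply: polyfunM; first exact: polyfun_cst.
  by apply: polyfun_prod => j; apply/polyfunX/polyfun_coord.
- move=> x.
  have H : \sum_(ml : 'I_(M ^ n) * 'I_M)
      u ml * (G ml.1 ml.2 (F x) * x 0 i0 ^+ ml.2) = 0.
    move: x; apply: (@line_degree_le_grid_eq0 _ _ E) => [|g]; last exact: hu.
    apply: line_degree_le_sum => ml.
    exact: (line_degree_leM (@line_degree_le_cst R n (u ml)) (hG _ _)).
  rewrite -[RHS]H.
  rewrite [RHS](eq_bigr (fun p => u (p.1, p.2) *
    (G p.1 p.2 (F x) * x 0 i0 ^+ p.2))); last by case.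
  rewrite -(pair_bigA _ (fun m l => u (m, l) * (G m l (F x) * x 0 i0 ^+ l))) /=.
  rewrite exchange_big /=.
  pose f l := \sum_(m < M ^ n) u (m, inord l) * (G m l (F x) * x 0 i0 ^+ l).
  transitivity (\sum_(l < M) f l).
    transitivity (\sum_(l < d.+1) f l).
      apply: eq_bigr => l _; rewrite mulr_suml; apply: eq_bigr => m _.
      by rewrite mulrA.
    rewrite (big_ord_widen _ f dM) [RHS](bigID (fun l : 'I_M => (l < d.+1)%N)) /=.
    rewrite [X in _ + X]big1 ?addr0 // => l.
    rewrite -leqNgt => dl; rewrite /f big1 // => m _.
    have [->|um] := eqVneq (u (m, inord l)) 0; first by rewrite mul0r.
    suff /dmax : P l by rewrite leqNgt dl.
    by rewrite /P ltn_ord; apply/existsP; exists m.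
  by apply: eq_bigr => l _; apply: eq_bigr => m _; rewrite inord_val.
- apply: contra_neq um1 => /(congr1 (fun p : {poly R} => p`_m1)).
  by rewrite coef0 coef_poly ltn_ord valK.
- move=> z; rewrite horner_poly; apply: eq_bigr => m _; rewrite valK.
  congr (_ * _); rewrite /G.
  under eq_bigr => j _ do rewrite mxE -exprM mulnC.
  by rewrite prodrXr sum_digits // modn_small.
Qed.

(** * Behaviour of a polynomial function near the unit sphere *)

Definition sqnorm (R : realType) n (y : 'rV[R]_n) : R := \sum_i y 0 i ^+ 2.

Lemma polyfun_sqnorm (R : realType) n : polyfun (@sqnorm R n).
Proof. by apply: polyfun_sum => i; apply/polyfunX/polyfun_coord. Qed.

Lemma sqnorm_ge0 (R : realType) n (y : 'rV[R]_n) : 0 <= sqnorm y.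
Proof. by apply: sumr_ge0 => i _; exact: sqr_ge0. Qed.

Lemma sqr_coord_le_sqnorm (R : realType) n (y : 'rV[R]_n) i :
  y 0 i ^+ 2 <= sqnorm y.
Proof.
by rewrite /sqnorm (bigD1 i) //= lerDl sumr_ge0 // => j _; exact: sqr_ge0.
Qed.

Lemma sqnormZ (R : realType) n t (y : 'rV[R]_n) :
  sqnorm (t *: y) = t ^+ 2 * sqnorm y.
Proof.
by rewrite /sqnorm mulr_sumr; apply: eq_bigr => i _; rewrite mxE exprMn.
Qed.

(** For a unit vector [y], the first nonzero coefficient in [t] gives the order of vanishing across
    the sphere at [y]. Coefficients polynomial in [y] are continuous in the direction. *)
Lemma radial_expansion (R : realType) n (a : 'rV[R]_n -> R) : polyfun a ->
  exists (N : nat) (B : 'rV[R]_n -> {poly R}),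
    [/\ forall k, polyfun (fun y => (B y)`_k), forall y, (size (B y) <= N)%N &
        forall y t, a ((1 + t) *: y) = (B y).[t]].
Proof.
elim=> [c|i|f g _ [N [B [B1 B2 B3]]] _ [N' [B' [B1' B2' B3']]]
  |f g _ [N [B [B1 B2 B3]]] _ [N' [B' [B1' B2' B3']]]].
- exists 1, (fun=> c%:P); split => [k|y|y t].
  + exact: polyfun_cst.
  + exact: size_polyC_leq1.
  + by rewrite hornerC.
- exists 2, (fun y => y 0 i *: (1 + 'X)); split => [k|y|y t].
  + rewrite (_ : (fun _ => _) = fun y : 'rV_n => y 0 i * (1 + 'X : {poly R})`_k).
      by apply: polyfunM; [exact: polyfun_coord|exact: polyfun_cst].
    by apply/funext => y; rewrite coefZ.
  + rewrite (leq_trans (size_scale_leq _ _)) // (leq_trans (size_polyD _ _)) //.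
    by rewrite size_poly1 size_polyX.
  + by rewrite !hornerE mxE mulrC.
- exists (maxn N N'), (fun y => B y + B' y); split => [k|y|y t].
  + rewrite (_ : (fun _ => _) = fun y => (B y)`_k + (B' y)`_k).
      exact: polyfunD.
    by apply/funext => y; rewrite coefD.
  + rewrite (leq_trans (size_polyD _ _)) // geq_max !leq_max.
    by rewrite B2 B2' orbT.
  + by rewrite hornerD B3 B3'.
- exists (N + N')%N, (fun y => B y * B' y); split => [k|y|y t].
  + rewrite (_ : (fun _ => _) =
      fun y => \sum_(i < k.+1) (B y)`_i * (B' y)`_(k - i)).
      by apply: polyfun_sum => i; exact: polyfunM.
    by apply/funext => y; rewrite coefM.
  + have := B2 y; have := B2' y; have := size_polyMleq (B y) (B' y); lia.
  + by rewrite hornerM B3 B3'.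
Qed.

(* [k] is the order of vanishing of [a] along the sphere; it plays the role of
   the exponent of [|y|^2 - 1] in a factorization of [a]. *)
Lemma radial_lower_bound (R : realType) n (a : 'rV[R]_n -> R) : polyfun a ->
  (exists2 y, 1 < sqnorm y & a y != 0) ->
  exists (k : nat) (u : 'rV[R]_n) (delta eps : R),
    [/\ sqnorm u = 1, 0 < delta, 0 < eps & forall y : 'rV[R]_n,
      (forall i, `|y 0 i - u 0 i| <= eps) -> 1 < sqnorm y ->
      delta * (Num.sqrt (sqnorm y) - 1) ^+ k <= `|a y|].
Proof.
move=> pa [y0 y01 ay0]; have [N [B [B1 B2 B3]]] := radial_expansion pa.
(* Polar coordinates: [y = (1 + tau y) *: dir y] outside the ball. *)
pose dir (y : 'rV[R]_n) := (Num.sqrt (sqnorm y))^-1 *: y.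
pose tau (y : 'rV[R]_n) := Num.sqrt (sqnorm y) - 1.
have dirP y : 1 < sqnorm y -> sqnorm (dir y) = 1.
  move=> y1; rewrite sqnormZ exprVn sqr_sqrtr ?sqnorm_ge0 // mulVf //.
  by rewrite gt_eqF // (lt_trans ltr01).
have aE y : 1 < sqnorm y -> a y = (B (dir y)).[tau y].
  move=> y1; rewrite -B3 /tau subrKC scalerA mulfV ?scale1r //.
  by rewrite gt_eqF // sqrtr_gt0 (lt_trans ltr01).
pose P k := `[< exists2 v : 'rV[R]_n, sqnorm v = 1 & (B v)`_k != 0 >].
have exP : exists k, P k.
  exists (size (B (dir y0))).-1; apply/asboolP; exists (dir y0); first exact: dirP.
  rewrite -lead_coefE lead_coef_eq0; apply: contra_neq ay0 => B0.
  by rewrite aE // B0 horner0.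
case: (ex_minnP exP) => k /asboolP[u u1 Bu] kmin.
(* By minimality of [k], [c] is the quotient of [a] by [tau ^+ k] outside the ball. *)
pose c y := \sum_(j < N) (B (dir y))`_(k + j) * tau y ^+ j.
have cu : c u = (B u)`_k.
  have tu : tau u = 0 by rewrite /tau u1 sqrtr1 subrr.
  have du : dir u = u by rewrite /dir u1 sqrtr1 invr1 scale1r.
  have N0 : (0 < N)%N.
    apply: leq_trans (B2 u); rewrite lt0n size_poly_eq0.
    by apply: contra_neq Bu => ->; rewrite coef0.
  rewrite /c tu du (bigD1 (Ordinal N0)) //= addn0 expr0 mulr1.
  rewrite big1 ?addr0 // => j; rewrite -val_eqE /= => j0.
  by rewrite expr0n (negbTE j0) mulr0.
have ac y : 1 < sqnorm y -> a y = tau y ^+ k * c y.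
  move=> y1; rewrite aE // (@horner_coef_wide _ (k + N)); last first.
    by rewrite (leq_trans (B2 _)) // leq_addl.
  rewrite big_split_ord /= big1 ?add0r => [|j _].
    by rewrite /c mulr_sumr; apply: eq_bigr => j _; rewrite exprD mulrCA.
  have [->|Bj] := eqVneq (B (dir y))`_j 0; first by rewrite mul0r.
  suff /kmin : P j by rewrite leqNgt ltn_ord.
  by apply/asboolP; exists (dir y); first exact: dirP.
have csqrt : {for u, continuous (fun y : 'rV[R]_n => Num.sqrt (sqnorm y))}.
  apply: (@continuous_comp _ _ _ (@sqnorm R n) Num.sqrt).
    exact/polyfun_continuous/polyfun_sqnorm.
  exact: sqrt_continuous.
have cdir : {for u, continuous dir}.
  have su : Num.sqrt (sqnorm u) != 0 by rewrite u1 sqrtr1 oner_neq0.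
  have cinv : (fun y : 'rV[R]_n => (Num.sqrt (sqnorm y))^-1) @ u -->
      (Num.sqrt (sqnorm u))^-1.
    exact: (@cvgV R _ (nbhs u) _ _ _ su csqrt).
  exact: (@cvgZ R 'rV[R]_n _ (nbhs u) _ _ id _ _ cinv cvg_id).
have ctau : {for u, continuous tau}.
  have cN1 : (fun _ : 'rV[R]_n => - 1 : R) @ u --> (- 1 : R) by exact: cst_continuous.
  exact: (cvgD csqrt cN1).
have cc : {for u, continuous c}.
  have cB m : continuous_at u (fun y => (B (dir y))`_m).
    apply: (@continuous_comp _ _ _ dir (fun y => (B y)`_m)) => //.
    exact/polyfun_continuous/B1.
  have ctauX m : continuous_at u (fun y => tau y ^+ m).
    elim: m => [|m IH]; first exact: cst_continuous.
    rewrite (_ : (fun _ => _) = fun y => tau y * tau y ^+ m).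
      exact: (cvgM ctau IH).
    by apply/funext => y; rewrite exprS.
  rewrite /prop_for /= /c; elim: (index_enum 'I_N) => [|j r IH].
    rewrite (_ : (fun _ => _) = fun=> 0); first exact: cst_continuous.
    by apply/funext => y; rewrite big_nil.
  rewrite (_ : (fun _ => _) = fun y => (B (dir y))`_(k + j) * tau y ^+ j +
    \sum_(j <- r) (B (dir y))`_(k + j) * tau y ^+ j).
    exact: (cvgD (cvgM (cB _) (ctauX _)) IH).
  by apply/funext => y; rewrite big_cons.
(* Half of [|c u|]: where [c] differs from [c u] by less than [delta], its absolute value is at
   least [delta]. *)
pose delta := `|(B u)`_k| / 2.
have delta0 : 0 < delta by rewrite divr_gt0 // normr_gt0.
have : \forall y \near u, `|c u - c y| < delta.
  by move/cvgrPdist_lt : cc; apply.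
move=> /nbhs_ballP[e /= e0 he].
exists k, u, delta, (e / 2); split => // [|y yu y1]; first by rewrite divr_gt0.
have : `|c u - c y| < delta.
  apply: he; split => // i j; rewrite ord1 /ball /= distrC (le_lt_trans (yu j)) //.
  by rewrite ltr_pdivrMr // ltr_pMr // ltr1n.
have tau0 : 0 <= tau y.
  by rewrite subr_ge0 -sqrtr1 ler_wsqrtr // ltW.
move=> cuy; rewrite ac // normrM [leRHS]mulrC normrX (ger0_norm tau0).
rewrite ler_wpM2r ?exprn_ge0 //.
have := ler_normB (c y) (c y - c u); rewrite opprB addrC subrK => h.
have : `|c u| = delta * 2 by rewrite cu /delta divfK // pnatr_eq0.
by rewrite distrC in cuy; lra.
Qed.

(** * Bounds on boxes, and points going to infinity with bounded image *)

Lemma polyfun_box_gt0 (R : realType) n (f : 'rV[R]_n -> R) (T : R) :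
  polyfun f -> (forall x, 0 < f x) -> 0 <= T ->
  exists2 mu, 0 < mu & forall x : 'rV[R]_n, (forall i, `|x 0 i| <= T) -> mu <= f x.
Proof.
move=> pf f0 T0.
pose A := [set v : 'rV[R]_n | forall i, `[- T, T]%classic (v 0 i)].
have [|||c _ hc] := @EVT_min_rV R n f A.
- by exists (0 : 'rV[R]_n) => i /=; rewrite mxE in_itv /= oppr_le0 T0.
- exact: (@rV_compact R n (fun=> `[- T, T]%classic) (fun=> @segment_compact _ _ _)).
- exact/continuous_subspaceT/polyfun_continuous.
exists (f c) => // x hx; apply: hc; rewrite inE => i /=.
by rewrite in_itv /= -ler_norml.
Qed.

(** [a] is the product of the leading coefficients of the relations. Dividing the relation for [x_i]
    by a power of [x_i] bounds its leading coefficient times [x_i] by the other coefficients. If [F]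
    were constant on the line along axis [j], the relation for [x_j] would have infinitely many
    roots, so its leading coefficient would vanish. *)
Lemma polyfun_nonproper_locus (R : realType) n (F : 'rV[R]_n.+1 -> 'rV[R]_n.+1) :
  (forall i, polyfun (fun x => F x 0 i)) ->
  exists a : 'rV[R]_n.+1 -> R,
    [/\ polyfun a, exists2 y, 1 < sqnorm y & a y != 0,
        forall B, exists2 C, 0 <= C & forall x i T,
          (forall j, `|F x 0 j| <= B) -> 1 <= T -> T <= `|x 0 i| ->
          `|a (F x)| * T <= C &
        forall x j, a (F x) != 0 ->
          exists s, F (x + s *: delta_mx 0 j) != F x].
Proof.
move=> pF; have [D hD] := polyfun_family_line_degree pF.
have [M hM] := algebraic_relation hD.
have /choice[d /choice[A /choice[q hAq]]] := hM.
pose a y := \prod_i A i (d i) y.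
have pa : polyfun a by apply: polyfun_prod => i; case: (hAq i).
have Arel i x : \sum_(l < (d i).+1) A i l (F x) * x 0 i ^+ l = 0.
  by case: (hAq i).
exists a; split => //.
- pose Q := \prod_i q i.
  have Q0 : Q != 0 by apply/prodf_neq0 => i _; case: (hAq i).
  (* [k >= 2] makes the first coordinate [k ^ (M.+1 ^ 0)] of the Kronecker point exceed 1, which
     puts it outside the ball. *)
  have [k k2 Qk] : exists2 k : nat, (2 <= k)%N & Q.[k%:R] != 0.
    apply: contrapT => h; move/eqP : Q0; apply.
    apply: (@poly_eq0_nat _ _ 2) => k k2.
    by apply: contra_notP h => /eqP h; exists k.
  exists (\row_j k%:R ^+ (M.+1 ^ j)).
    apply: lt_le_trans (sqr_coord_le_sqnorm _ ord0).
    by rewrite mxE expr1 exprn_egt1 // ltr1n.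
  move: Qk; rewrite /Q horner_prod; apply: contra_neq => <-.
  by apply: eq_bigr => i _; case: (hAq i).
- move=> B.
  have /choice[K hK] i : exists K, 0 <= K /\
      forall y : 'rV[R]_n.+1, (forall j, `|y 0 j| <= B) -> `|A i (d i) y| <= K.
    have [|C C0 hC] := @polyfun_bounded R _ (A i (d i)) B; last by exists C.
    by case: (hAq i).
  have /choice[L hL] i : exists L, 0 <= L /\
      forall y : 'rV[R]_n.+1, (forall j, `|y 0 j| <= B) ->
        \sum_(l < d i) `|A i l y| <= L.
    have /choice[C hC] (l : 'I_(d i)) : exists C, 0 <= C /\
        forall y : 'rV[R]_n.+1, (forall j, `|y 0 j| <= B) -> `|A i l y| <= C.
      have [|C C0 hC] := @polyfun_bounded R _ (A i l) B; last by exists C.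
      by case: (hAq i).
    exists (\sum_l C l); split => [|y yB].
      by apply: sumr_ge0 => l _; case: (hC l).
    by apply: ler_sum => l _; case: (hC l) => _; apply.
  pose c i := L i * \prod_(j | j != i) K j.
  have c0 i : 0 <= c i.
    rewrite mulr_ge0 //; first by case: (hL i).
    by apply: prodr_ge0 => j _; case: (hK j).
  exists (\sum_i c i); first exact: sumr_ge0.
  move=> x i T yB T1 Tx.
  apply: (@le_trans _ _ (c i)); last first.
    by rewrite (bigD1 i) //= lerDl sumr_ge0.
  rewrite /a (bigD1 i) //= normrM mulrAC ler_pM //; first last.
  + rewrite normr_prod; apply: ler_prod => j _; rewrite normr_ge0 /=.
    by case: (hK j) => _; apply.
  + case: (hL i) => _ /(_ _ yB); apply: le_trans.
    have x0 : 0 < `|x 0 i| by apply: lt_le_trans Tx; lra.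
    apply: (@le_trans _ _ (`|A i (d i) (F x)| * `|x 0 i|)).
      by rewrite ler_wpM2l.
    have := Arel i x; rewrite big_ord_recr /= => /eqP.
    rewrite addrC addr_eq0 => /eqP AE.
    (* In degree 0 the relation says that the leading coefficient is 0; otherwise divide by
       [|x 0 i| ^+ e], which dominates the lower powers. *)
    case di : (d i) AE => [|e] AE.
      move: AE; rewrite !big_ord0 oppr0 expr0 mulr1 => ->.
      by rewrite normr0 mul0r.
    rewrite -(ler_pM2r (exprn_gt0 e x0)) -mulrA -exprS -normrX -normrM AE.
    rewrite normrN (le_trans (ler_norm_sum _ _ _)) // mulr_suml.
    apply: ler_sum => l _; rewrite normrM normrX ler_wpM2l //.
    by rewrite ler_weXn2l // ?(le_trans T1) // -ltnS.
  + exact: mulr_ge0 (normr_ge0 _) (le_trans ler01 T1).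
- move=> x j; apply: contra_neqP => /forallNP h.
  have Fc s : F (x + s *: delta_mx 0 j) = F x.
    by apply/eqP; rewrite -[_ == _]negbK; apply/negP/h.
  pose Q := \poly_(l < (d j).+1) A j l (F x).
  have Q0 : Q = 0.
    apply: (@poly_eq0_nat _ _ 0) => k _.
    have := Arel j (x + (k%:R - x 0 j) *: delta_mx 0 j).
    by rewrite Fc !mxE !eqxx mulr1 subrKC => Ak; rewrite -[RHS]Ak horner_poly.
  have : Q`_(d j) = 0 by rewrite Q0 coef0.
  by rewrite coef_poly ltnSn /a (bigD1 j) //= => ->; rewrite mul0r.
Qed.

(** * Polynomial curves close to the sphere *)

(* If [\sum_m W_m^2] is within a tiny [eta] of [1] on [-1, 1], then it is at
   most [2] on a long interval [-S, S]; so the [W_m] are bounded there, which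
   makes their nonconstant coefficients of size [1 / S]. *)
Lemma near_sphere_curve_near_constant (R : realType) (n D : nat) (eps : R) :
  0 < eps -> exists2 eta : R, 0 < eta & forall W : 'I_n -> {poly R},
    (forall m, (size (W m) <= D.+1)%N) ->
    (forall s, `|s| <= 1 -> `|\sum_m (W m).[s] ^+ 2 - 1| <= eta) ->
    \sum_m \sum_(l < D) `|(W m)`_l.+1| < eps.
Proof.
move=> eps0; have [K K0 hK] := coef_le_sup R D.
have [K' K'0 hK'] := coef_le_sup R (2 * D).
(* [n * D] coefficients of size at most [2 * K / S] then add up to less than [eps]. *)
pose S := 1 + (n * D)%:R * (2 * K) / eps.
have S1 : 1 <= S by rewrite lerDl divr_ge0 ?mulr_ge0 // ltW.
have S0 : 0 < S by rewrite (lt_le_trans ltr01).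
(* With [eta = L^-1], the [(2 * D).+1] terms of [Q] on [[-S, S]] add up to at most 1. *)
pose L := (2 * D).+1%:R * (K' * S ^+ (2 * D)).
have L0 : 0 < L by rewrite !mulr_gt0 // exprn_gt0.
exists L^-1 => [|W sW hW]; first by rewrite invr_gt0.
pose Q := \sum_m W m ^+ 2 - 1.
have QE s : Q.[s] = \sum_m (W m).[s] ^+ 2 - 1.
  by rewrite !hornerE horner_sum; under eq_bigr do rewrite horner_exp.
have sQ : (size Q <= (2 * D).+1)%N.
  rewrite (leq_trans (size_polyD _ _)) // geq_max size_polyN size_poly1 andbT.
  rewrite (leq_trans (size_sum _ _ _)) //; apply/bigmax_leqP => m _.
  by rewrite (leq_trans (size_polyMleq _ _)) //; have := sW m; lia.
have cQ l : `|Q`_l| <= K' * L^-1.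
  by apply: hK' => // s s1; rewrite QE hW.
have QS s : `|s| <= S -> `|Q.[s]| <= 1.
  move=> sS; rewrite (horner_coef_wide _ sQ) (le_trans (ler_norm_sum _ _ _)) //.
  apply: (@le_trans _ _ (\sum_(l < (2 * D).+1) K' * L^-1 * S ^+ (2 * D))).
    apply: ler_sum => l _; rewrite normrM ler_pM // normrX.
    apply: (@le_trans _ _ (S ^+ l)); first by rewrite lerXn2r ?nnegrE ?normr_ge0 // ltW.
    by rewrite ler_weXn2l // -ltnS.
  rewrite sumr_const card_ord -mulr_natl [K' * _ * _]mulrAC mulrA.
  by rewrite -/L mulfV // gt_eqF.
have WS m s : `|s| <= S -> `|(W m).[s]| <= 2.
  move=> /QS; rewrite QE ler_norml => /andP[_ h].
  rewrite -(@ler_pXn2r _ 2) ?nnegrE // real_normK ?num_real //.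
  apply: (@le_trans _ _ (\sum_m (W m).[s] ^+ 2)); last by lra.
  by rewrite (bigD1 m) //= lerDl sumr_ge0 // => i _; exact: sqr_ge0.
have cW m (l : 'I_D) : `|(W m)`_l.+1| <= K * 2 / S.
  pose V := \poly_(l < D.+1) ((W m)`_l * S ^+ l).
  have VE s : V.[s] = (W m).[S * s].
    rewrite horner_poly (horner_coef_wide _ (sW m)).
    by apply: eq_bigr => i _; rewrite exprMn mulrA.
  have : `|V`_l.+1| <= K * 2.
    apply: hK => [|s s1]; first exact: size_poly.
    by rewrite VE WS // normrM gtr0_norm // ler_piMr // ltW.
  rewrite coef_poly ltnS ltn_ord normrM (gtr0_norm (exprn_gt0 _ S0)).
  rewrite ler_pdivlMr //; apply: le_trans; rewrite ler_wpM2l //.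
  by rewrite exprS ler_peMr ?exprn_ege1 // ltW.
apply: (@le_lt_trans _ _ (\sum_(m < n) \sum_(l < D) K * 2 / S)).
  by apply: ler_sum => m _; apply: ler_sum => l _; exact: cW.
rewrite !sumr_const !card_ord -mulrnA -[ltLHS]mulr_natl mulrA ltr_pdivrMr //.
have -> : eps * S = eps + (n * D)%:R * (2 * K) by rewrite /S; field; rewrite gt_eqF.
by rewrite mulnC (mulrC K) ltrDr.
Qed.

(** Intermediate value theorem for the total size of the nonconstant terms: it is 0 at 0, and at
    [b >= 1] the single term of [m0] and [l0] already reaches [eps]. *)
Lemma rescale_to_variation (R : rcfType) (n D : nat) (w : 'I_n -> {poly R}) (eps : R) :
  0 < eps -> (exists m (l : 'I_D), (w m)`_l.+1 != 0) ->
  exists lambda : R, \sum_m \sum_(l < D) `|(w m)`_l.+1 * lambda ^+ l.+1| = eps.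
Proof.
move=> eps0 [m0 [l0 w0]].
pose g := \sum_m \sum_(l < D) `|(w m)`_l.+1| *: 'X^(l.+1).
have gE t : g.[t] = \sum_m \sum_(l < D) `|(w m)`_l.+1| * t ^+ l.+1.
  rewrite horner_sum; apply: eq_bigr => m _; rewrite horner_sum.
  by apply: eq_bigr => l _; rewrite !hornerE.
pose b := 1 + eps / `|(w m0)`_l0.+1|.
have b1 : 1 <= b by rewrite lerDl divr_ge0 // ltW.
have b0 : 0 <= b by rewrite (le_trans ler01).
have [||t /andP[t0 _] /rootP gt] := @poly_ivt R (g - eps%:P) 0 b.
- exact: b0.
- rewrite !hornerE !gE; apply/andP; split.
    rewrite big1 ?sub0r ?oppr_le0 ?ltW // => m _.
    by rewrite big1 // => l _; rewrite expr0n mulr0.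
  rewrite subr_ge0 (bigD1 m0) //= (bigD1 l0) //=.
  rewrite -addrA ler_wpDr //.
    by rewrite addr_ge0 // ?sumr_ge0 // => *; rewrite ?sumr_ge0 // => *;
       rewrite mulr_ge0 // exprn_ge0.
  apply: (@le_trans _ _ (`|(w m0)`_l0.+1| * b)).
    by rewrite mulrDr mulr1 mulrCA mulfV ?normr_eq0 // mulr1 lerDr.
  by rewrite ler_wpM2l // exprS ler_peMr // exprn_ege1.
exists t; move: gt; rewrite !hornerE gE => /eqP; rewrite subr_eq0 => /eqP <-.
apply: eq_bigr => m _; apply: eq_bigr => l _.
by rewrite normrM normrX (ger0_norm t0).
Qed.

(** * The contradiction for the unit ball *)

Lemma unit_ball_complement_not_polynomial_image (R : realType) n
    (F : 'rV[R]_n.+2 -> 'rV[R]_n.+2) :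
  (forall i, polyfun (fun x => F x 0 i)) -> (forall x, 1 < sqnorm (F x)) ->
  ~ (forall y, 1 < sqnorm y -> exists x, F x = y).
Proof.
move=> pF F1 Fsurj.
have [D hD] := polyfun_family_line_degree pF.
have [a [pa a_neq0 a_small a_fibre]] := polyfun_nonproper_locus pF.
have [k [u [delta [eps [u1 delta0 eps0 hlow]]]]] := radial_lower_bound pa a_neq0.
(* Half of [eps] is for the distance from [u] to the starting point, half for the motion of the
   curve. *)
pose e := eps / 2.
have e0 : 0 < e by rewrite divr_gt0.
have [eta' eta'0 hcurve] := @near_sphere_curve_near_constant R n.+2 D e e0.
(* For [0 <= tau < eta], this gives [(1 + tau) ^+ 2 - 1 <= 3 * eta <= eta']. *)
pose eta := Num.min 1 (eta' / 4).
have eta0 : 0 < eta by rewrite lt_min ltr01 divr_gt0.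
have eta1 : eta <= 1 by rewrite ge_min lexx.
have eta2 : eta <= eta' / 4 by rewrite ge_min lexx orbT.
have [C C0 hC] := a_small (1 + eps).
(* So large that [|a (F z)| * T <= C] excludes [delta * eta ^+ k <= |a (F z)|]. *)
pose T := 1 + C / (delta * eta ^+ k).
have dek0 : 0 < delta * eta ^+ k by rewrite mulr_gt0 // exprn_gt0.
have T1 : 1 <= T by rewrite lerDl divr_ge0 // ltW.
have CT : C < delta * eta ^+ k * T.
  rewrite /T mulrDr mulr1 [X in _ < _ + X]mulrC divfK ?gt_eqF //.
  by rewrite ltrDr.
have [|x|mu mu0 hmu] := @polyfun_box_gt0 R n.+2
  (fun x => sqnorm (F x) + -1) T _ _ (le_trans ler01 T1).
- apply: polyfunD; last exact: polyfun_cst.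
  by apply: polyfun_sum => i; exact/polyfunX/pF.
- by rewrite subr_gt0.
(* Then [(1 + t) ^+ 2 - 1 <= 3 * t < mu], so the preimages of [y0] lie outside the box of size [T],
   while [t <= e] keeps [y0] near [u]. *)
pose t := Num.min 1 (Num.min e (mu / 4)).
have t0 : 0 < t by rewrite !lt_min ltr01 e0 divr_gt0.
have t1 : t <= 1 by rewrite ge_min lexx.
have te : t <= e by rewrite !ge_min lexx orbT.
have tmu : t <= mu / 4 by rewrite !ge_min lexx !orbT.
have uc i : `|u 0 i| <= 1.
  rewrite -(@ler_pXn2r _ 2) ?nnegrE // real_normK ?num_real // expr1n -u1.
  exact: sqr_coord_le_sqnorm.
pose y0 := (1 + t) *: u.
have y0n : sqnorm y0 = (1 + t) ^+ 2 by rewrite sqnormZ u1 mulr1.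
have y01 : 1 < sqnorm y0 by rewrite y0n; nra.
have [x Fx] := Fsurj _ y01.
have y0u i : `|y0 0 i - u 0 i| <= e.
  rewrite !mxE mulrDl mul1r addrAC subrr add0r normrM (gtr0_norm t0).
  by apply: le_trans te; rewrite ler_piMr // ltW.
have ay0 : a (F x) != 0.
  rewrite Fx -normr_gt0; apply: lt_le_trans (hlow _ _ y01).
    rewrite y0n sqrtr_sqr ger0_norm ?addr_ge0 // ?ltW //.
    by rewrite addrAC subrr add0r mulr_gt0 // exprn_gt0.
  by move=> i; apply: le_trans (y0u i) _; rewrite /e; lra.
have [i Txi] : exists i, T <= `|x 0 i|.
  apply: contrapT => /forallNP h.
  have : mu <= sqnorm (F x) + -1.
    by apply: hmu => i; have /negP := h i; rewrite -ltNge => /ltW.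
  by rewrite Fx y0n; nra.
have [j ij] : exists j : 'I_n.+2, j != i.
  by exists (lift i ord0); rewrite eq_sym neq_lift.
pose v : 'rV[R]_n.+2 := delta_mx 0 j.
have /choice[w hw] m : exists w : {poly R},
    (size w <= D.+1)%N /\ forall s, F (x + s *: v) 0 m = w.[s].
  by have [w sw hw] := hD m x v; exists w.
have [lam hlam] : exists lambda : R,
    \sum_m \sum_(l < D) `|(w m)`_l.+1 * lambda ^+ l.+1| = e.
  (* Otherwise [F] would be constant on the line, which [a (F x) != 0] forbids. *)
  apply: rescale_to_variation => //; apply: contrapT => hN.
  have [s /eqP] := a_fibre x j ay0; apply; apply/rowP => m.
  have [sw wE] := hw m.
  have -> : F x 0 m = (w m).[0] by rewrite -wE scale0r addr0.
  rewrite wE !(horner_coef_wide _ sw) !big_ord_recl !expr0; congr (_ + _).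
  apply: eq_bigr => l _; suff -> : (w m)`_(lift ord0 l) = 0 by rewrite !mul0r.
  apply: contrapT => /eqP wl; apply: hN; by exists m, l.
pose W m := \poly_(l < D.+1) ((w m)`_l * lam ^+ l).
have WE m s : (W m).[s] = F (x + (lam * s) *: v) 0 m.
  have [sw ->] := hw m; rewrite horner_poly (horner_coef_wide _ sw).
  by apply: eq_bigr => l _; rewrite exprMn mulrA.
have WC m (l : 'I_D) : (W m)`_l.+1 = (w m)`_l.+1 * lam ^+ l.+1.
  by rewrite coef_poly ltnS ltn_ord.
(* The choice of [lam] makes this variation equal to [e], so a strict bound is absurd. *)
suff : \sum_m \sum_(l < D) `|(W m)`_l.+1| < e.
  rewrite (eq_bigr (fun m => \sum_(l < D) `|(w m)`_l.+1 * lam ^+ l.+1|)).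
    by rewrite hlam ltxx.
  by move=> m _; apply: eq_bigr => l _; rewrite WC.
apply: hcurve => [m|s s1]; first exact: size_poly.
set z := x + (lam * s) *: v.
have sqE : \sum_m (W m).[s] ^+ 2 = sqnorm (F z).
  by apply: eq_bigr => m _; rewrite WE.
have Wy0 m : `|F z 0 m - y0 0 m| <= e.
  rewrite -WE.
  have -> : y0 0 m = (W m).[0] by rewrite WE mulr0 scale0r addr0 Fx.
  have sW : (size (W m) <= D.+1)%N by exact: size_poly.
  rewrite !(horner_coef_wide _ sW) !big_ord_recl !expr0 opprD addrACA subrr add0r.
  rewrite [X in _ - X]big1 ?subr0 => [|l _]; last by rewrite expr0n mulr0.
  apply: (le_trans (ler_norm_sum _ _ _)); rewrite -hlam.
  rewrite [leRHS](bigD1 m) //= ler_wpDr ?sumr_ge0 // => [? _|].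
    by rewrite sumr_ge0.
  apply: ler_sum => l _; rewrite normrM -WC normrX.
  by rewrite ler_piMr // exprn_ile1.
have zu m : `|F z 0 m - u 0 m| <= eps.
  rewrite -[F z 0 m](subrK (y0 0 m)) -addrA (le_trans (ler_normD _ _)) //.
  by have := lerD (Wy0 m) (y0u m); rewrite /e -splitr.
(* Moving along axis [j] keeps coordinate [i] large, so the smallness of [a] holds on the whole
   curve. *)
have zi : z 0 i = x 0 i by rewrite !mxE /= [i == j]eq_sym (negbTE ij) !mulr0 addr0.
have : `|a (F z)| * T <= C.
  apply: (hC z i) => //; last by rewrite zi.
  move=> m; rewrite -[F z 0 m](subrK (u 0 m)) (le_trans (ler_normD _ _)) //.
  by rewrite addrC lerD.
set tau := Num.sqrt (sqnorm (F z)) - 1.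
have tau0 : 0 <= tau by rewrite subr_ge0 -sqrtr1 ler_wsqrtr // ltW.
have alow : delta * tau ^+ k <= `|a (F z)| by exact: hlow.
move=> aTC.
have taueta : tau < eta.
  rewrite ltNge; apply/negP => h.
  suff : delta * eta ^+ k * T <= C by rewrite leNgt CT.
  apply: le_trans aTC; rewrite ler_wpM2r ?(le_trans ler01) //.
  apply: le_trans alow; rewrite ler_wpM2l ?(ltW delta0) //.
  by rewrite lerXn2r // nnegrE // ltW.
rewrite sqE.
have -> : sqnorm (F z) = (1 + tau) ^+ 2.
  by rewrite /tau subrKC sqr_sqrtr // sqnorm_ge0.
by rewrite ger0_norm; nra.
Qed.

(** * Reduction of an arbitrary ball to the unit ball *)

Theorem mainTheorem6 (R : realType) (n : nat) (hn : (2 <= n)%N)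
    (c : 'rV[R]_n) (r : R) (hr : 0 < r) :
  ~ polynomial_image (~` closed_eball c r).
Proof.
case: n hn c => [|[|n]] // _ c [p hp].
have enormE (x : 'rV[R]_n.+2) : enorm x = Num.sqrt (sqnorm x) by [].
have r0 : r != 0 by rewrite gt_eqF.
have outside x : (~` closed_eball c r) x <-> 1 < sqnorm (r^-1 *: (x - c)).
  rewrite /closed_eball /= enormE sqnormZ exprVn mulrC ltr_pdivlMr ?exprn_gt0 //.
  rewrite mul1r -{1}(gtr0_norm hr) -sqrtr_sqr ler_sqrt ?sqr_ge0 // ltNge.
  by split => /negP.
(* The similarity taking the ball to the unit ball keeps the components polynomial. *)
pose F x := r^-1 *: (poly_map p x - c).
apply: (@unit_ball_complement_not_polynomial_image R n F) => [i|x|y y1].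
- rewrite (_ : (fun _ => _) = fun x : 'rV[R]_n.+2 =>
    r^-1 * (mpoly.meval (fun j => x 0 j) (p i) + (- c 0 i))).
    apply: polyfunM; first exact: polyfun_cst.
    by apply: polyfunD; [exact: polyfun_meval|exact: polyfun_cst].
  by apply/funext => x; rewrite !mxE.
- by apply/outside; rewrite hp; exists x.
- have : (~` closed_eball c r) (c + r *: y).
    by apply/outside; rewrite addrAC subrr add0r scalerA mulVf // scale1r.
  rewrite hp => -[x _ xE]; exists x.
  by rewrite /F xE addrAC subrr add0r scalerA mulVf // scale1r.
Qed.
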